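(* If a domain $U\subset\mathbb{C}^n$ satisfies the continuity principle, then it is pseudoconvex.
   Context: A domain is a connected open set. A function $f\colon U\to\mathbb{R}$ is an exhaustion function for $U$ if $f^{-1}((-\infty,r])$ is compact for every $r\in\mathbb{R}$. An upper-semicontinuous function $f\colon V\to[-\infty,\infty)$ on an open set $V\subset\mathbb{C}$ is subharmonic if for every closed disc $\overline{B(a,r)}\subset V$ ($r>0$) and every continuous $\phi\colon\overline{B(a,r)}\to\mathbb{R}$ that is harmonic on $B(a,r)$ with $\phi\ge f$ on $\partial B(a,r)$, one has $\phi\ge f$ on $B(a,r)$. An upper-semicontinuous $f\colon V\to[-\infty,\infty)$ on an open $V\subset\mathbb{C}^n$ is plurisubharmonic if for every $a\in V$ and $\delta\in\mathbb{C}^n$ with $|\delta|=1$ the function $z\mapsto f(a+\delta z)$ is subharmonic on $\{z\in\mathbb{C}: a+\delta z\in V\}$. A domain $U\subset\mathbb{C}^n$ is pseudoconvex if it admits a continuous plurisubharmonic exhaustion function $U\to\mathbb{R}$. Write $B(0,1)$ for the open unit disc in $\mathbb{C}$. A holomorphic disc is a continuous map $S\colon\overline{B(0,1)}\to\mathbb{C}^n$ whose restriction to $B(0,1)$ is holomorphic; the image $S(B(0,1))$ is also denoted $S$, and the boundary is $\partial S:=S(\partial B(0,1))$. For sets $S_j,S$ in $\mathbb{C}^n$, $S_j\to S$ means: for every $\epsilon>0$ there is $J$ such that for all $j\ge J$, $S_j$ is contained in the $\epsilon$-enlargement of $S$ and $S$ is contained in the $\epsilon$-enlargement of $S_j$ (enlargements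 with respect to the $L^\infty$ metric $\max_k|z_k-w_k|$). A domain $U\subset\mathbb{C}^n$ satisfies the continuity principle if for every sequence $\{S_j\}_{j\ge1}$ of holomorphic discs with $S_j\cup\partial S_j\subset U$ for all $j$, $\partial S_j\to B$ and $S_j\to T$, where $B\subset U$ and $T\subset\mathbb{C}^n$ are compact, one has $T\subset U$. *)

(* Defs.v *)
From HB Require Import structures.
From mathcomp Require Export all_boot all_order all_algebra.
From mathcomp Require Export all_classical all_reals all_analysis.
From mathcomp Require Export complex.
Export Order.TTheory GRing.Theory Num.Theory.
Export numFieldNormedType.Exports.

Set Implicit Arguments.
Unset Strict Implicit.
Unset Printing Implicit Defensive.

Local Open Scope classical_set_scope.
Local Open Scope complex_scope.
Local Open Scope ring_scope.

(* R[i] seen through its numFieldType structure, which is what carries the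
   topology and the norm of the library: the norm takes values in R[i] itself,
   so real radii are injected with %:C. *)
Notation Cplx R :=
  (Num.NumField.sort (complex_complex__canonical__Num_NumField R)) (only parsing).

(* The topology, the norm `|v| (= max_k |v_k|) and the complex differentiability
   [derivable] on C^n are those of the library for 'rV[K]_n with K = C. *)
Notation Cn R n := 'rV[Cplx R]_n (only parsing).

Definition domain (T : topologicalType) (U : set T) : Prop :=
  open U /\ connected U.

Definition open_disc (R : realType) (a : Cplx R) (r : R) : set (Cplx R) :=
  [set z : Cplx R | `|z - a| < r%:C].

Definition closed_disc (R : realType) (a : Cplx R) (r : R) : set (Cplx R) :=
  [set z : Cplx R | `|z - a| <= r%:C].

Definition disc_boundary (R : realType) (a : Cplx R) (r : R) : set (Cplx R) :=
  [set z : Cplx R | `|z - a| = r%:C].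

(* Functions on a set V are total functions of which only the values on V
   matter. *)
Definition exhaustion (R : realType) (T : topologicalType) (U : set T)
    (f : T -> R) : Prop :=
  forall r : R, compact [set z | U z /\ f z <= r].

Definition upper_semicontinuous_on (R : realType) (T : topologicalType)
    (V : set T) (f : T -> \bar R) : Prop :=
  forall x, V x -> forall c : R, (f x < c%:E)%E ->
    \forall y \near within V (nbhs x), (f y < c%:E)%E.

(* For phi : C -> R, the derivative at z along the real line z + R v; with
   z = x + iy, v = 1 gives d/dx and v = 'i gives d/dy. *)
Definition partial_derivable (R : realType) (v : Cplx R) (phi : Cplx R -> R)
    (z : Cplx R) : Prop :=
  derivable (fun t : R => phi (z + v * t%:C)) 0 1.

Definition partial (R : realType) (v : Cplx R) (phi : Cplx R -> R) :
    Cplx R -> R :=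
  fun z => derive1 (fun t : R => phi (z + v * t%:C)) 0.

Definition C1_on (R : realType) (D : set (Cplx R)) (phi : Cplx R -> R) : Prop :=
  forall v : Cplx R, v = 1 \/ v = 'i%C ->
    (forall z, D z -> partial_derivable v phi z) /\
    {within D, continuous (partial v phi)}.

Definition C2_on (R : realType) (D : set (Cplx R)) (phi : Cplx R -> R) : Prop :=
  [/\ C1_on D phi, C1_on D (partial 1 phi) & C1_on D (partial 'i%C phi)].

Definition harmonic_on (R : realType) (D : set (Cplx R)) (phi : Cplx R -> R) :
    Prop :=
  C2_on D phi /\
  forall z, D z ->
    partial 1 (partial 1 phi) z + partial 'i%C (partial 'i%C phi) z = 0.

Definition subharmonic (R : realType) (V : set (Cplx R))
    (f : Cplx R -> \bar R) : Prop :=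
  [/\ forall z, V z -> (f z < +oo)%E,
      upper_semicontinuous_on V f &
      forall (a : Cplx R) (r : R) (phi : Cplx R -> R),
        0 < r -> closed_disc a r `<=` V ->
        {within closed_disc a r, continuous phi} ->
        harmonic_on (open_disc a r) phi ->
        (forall z, disc_boundary a r z -> (f z <= (phi z)%:E)%E) ->
        forall z, open_disc a r z -> (f z <= (phi z)%:E)%E].

Definition euclidean_norm (R : realType) (n : nat) (v : Cn R n) : R :=
  Num.sqrt (\sum_(k < n) (complex.Re (v 0 k) ^+ 2 + complex.Im (v 0 k) ^+ 2)).

Definition plurisubharmonic (R : realType) (n : nat) (V : set (Cn R n))
    (f : Cn R n -> \bar R) : Prop :=
  [/\ forall z, V z -> (f z < +oo)%E,
      upper_semicontinuous_on V f &
      forall a delta : Cn R n, V a -> euclidean_norm delta = 1 ->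
        subharmonic [set z : Cplx R | V (a + z *: delta)]
                    (fun z => f (a + z *: delta))].

Definition pseudoconvex (R : realType) (n : nat) (U : set (Cn R n)) : Prop :=
  domain U /\
  exists f : Cn R n -> R,
    [/\ {within U, continuous f},
        plurisubharmonic U (fun z => (f z)%:E) &
        exhaustion U f].

Definition holomorphic_disc (R : realType) (n : nat) (S : Cplx R -> Cn R n) :
    Prop :=
  {within closed_disc 0 1, continuous S} /\
  forall z, open_disc 0 1 z -> derivable S z 1.

Definition disc_image (R : realType) (n : nat) (S : Cplx R -> Cn R n) :
    set (Cn R n) := S @` open_disc 0 1.

Definition disc_image_boundary (R : realType) (n : nat)
    (S : Cplx R -> Cn R n) : set (Cn R n) := S @` disc_boundary 0 1.

Definition enlargement (R : realType) (n : nat) (A : set (Cn R n)) (e : R) :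
    set (Cn R n) :=
  [set w : Cn R n | exists2 s, A s & `|w - s| < e%:C].

Definition set_cvg (R : realType) (n : nat) (A : nat -> set (Cn R n))
    (L : set (Cn R n)) : Prop :=
  forall e : R, 0 < e -> exists J : nat, forall j : nat, (J <= j)%N ->
    A j `<=` enlargement L e /\ L `<=` enlargement (A j) e.

Definition continuity_principle (R : realType) (n : nat) (U : set (Cn R n)) :
    Prop :=
  forall (S : nat -> Cplx R -> Cn R n) (B T : set (Cn R n)),
    (forall j, holomorphic_disc (S j)) ->
    (forall j, disc_image (S j) `|` disc_image_boundary (S j) `<=` U) ->
    compact B -> B `<=` U -> compact T ->
    set_cvg (fun j => disc_image_boundary (S j)) B ->
    set_cvg (fun j => disc_image (S j)) T ->
    T `<=` U.

(* Main.v *)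
(* Let d(z) be the distance (for the max norm) from z to the complement of U,
   truncated at 1. The function max(|z|, 1/d(z)) is a continuous exhaustion
   function, and only the plurisubharmonicity of 1/d is not elementary. Suppose
   1/d <= phi on the boundary of a disc z |-> b + z d contained in U, with phi
   harmonic. On the circle, phi is uniformly approximated from above by Re p
   with p a polynomial. Given z0 in the disc, the polynomial
   q = p - i Im p(z0) satisfies 1/|q| <= 1/Re p <= d on the circle, so for
   |w| < 1 the holomorphic discs z |-> b + z d + l w / q(z), 0 <= l <= 1, all
   have their boundary in U. The one with l = 0 lies in U, so by the continuity
   principle all of them do. At z0 this shows that the ball of radius
   1/Re p(z0) around b + z0 d lies in U, that is, 1/d <= Re p at z0. Finally
   Re p <= phi + e holds inside the disc by the maximum principle. Working with
   1/d instead of -log d avoids the complex exponential. *)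
Require Import Defs.
From mathcomp Require Import ring lra zify.
From mathcomp Require Import cyclic separable cyclotomic.

Set Implicit Arguments.
Unset Strict Implicit.
Unset Printing Implicit Defensive.

Local Open Scope classical_set_scope.
Local Open Scope complex_scope.
Local Open Scope ring_scope.

(** * Real-valued norms on complex normed spaces *)

Lemma within_continuousT (T U : topologicalType) (A : set T) (f : T -> U) :
  (forall x, A x -> {for x, continuous f}) -> {within A, continuous f}.
Proof. by move=> cf; apply: continuous_in_subspaceT => x /set_mem; exact: cf. Qed.

Section RealNorm.
Variable R : realType.
Local Notation C := (Cplx R).

(** The library norm on a complex space takes values in [C]; its real part carries the same
    information and allows order, minima and suprema to be handled in [R]. *)
Definition rnorm (V : normedModType C) (v : V) : R := complex.Re `|v|.

Section NormedModule.
Variable V : normedModType C.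
Implicit Types (u v w : V) (e : R).

Lemma rnormE v : (rnorm v)%:C = `|v|.
Proof. by apply: RRe_real; exact: normr_real. Qed.

Lemma ltc_rnorm v e : (`|v| < e%:C) = (rnorm v < e).
Proof. by rewrite -rnormE ltcR. Qed.

Lemma lec_rnorm v e : (`|v| <= e%:C) = (rnorm v <= e).
Proof. by rewrite -rnormE lecR. Qed.

Lemma rnorm_ge0 v : 0 <= rnorm v.
Proof. by rewrite -lecR rnormE normr_ge0. Qed.

Lemma rnorm0 : rnorm (0 : V) = 0.
Proof. by apply: complexI; rewrite rnormE normr0. Qed.

Lemma rnormN v : rnorm (- v) = rnorm v.
Proof. by rewrite /rnorm normrN. Qed.

Lemma rnormBC u v : rnorm (u - v) = rnorm (v - u).
Proof. by rewrite /rnorm distrC. Qed.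

Lemma rnormD u v : rnorm (u + v) <= rnorm u + rnorm v.
Proof. by rewrite -lecR rmorphD /= !rnormE ler_normD. Qed.

Lemma rnorm_dist u v w : rnorm (u - w) <= rnorm (u - v) + rnorm (v - w).
Proof. by rewrite (le_trans _ (rnormD _ _))// subrKA. Qed.

Lemma rnorm_lip u v : `|rnorm u - rnorm v| <= rnorm (u - v).
Proof.
have := rnorm_dist u v 0; have := rnorm_dist v u 0.
by rewrite !subr0 rnormBC ler_norml => h1 h2; apply/andP; split; lra.
Qed.

Lemma rnormZ (a : C) v : rnorm (a *: v) = rnorm a * rnorm v.
Proof. by apply: complexI; rewrite rmorphM /= !rnormE normrZ. Qed.

Lemma nbhs_rnorm u (P : set V) :
  nbhs u P <-> exists2 e : R, 0 < e & forall v, rnorm (v - u) < e -> P v.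
Proof.
split.
  move=> /nbhs_normP[e /= e0 eP].
  have eE : e = (complex.Re e)%:C by rewrite RRe_real// gtr0_real.
  exists (complex.Re e); first by rewrite -ltcR -eE.
  by move=> v; rewrite -ltcR -eE rnormE => h; apply: eP; rewrite /= distrC.
move=> [e e0 eP]; apply/nbhs_normP; exists e%:C; first by rewrite /= ltcR.
by move=> v /=; rewrite distrC ltc_rnorm => /eP.
Qed.

End NormedModule.

Implicit Types z w : C.

Lemma rnormM z w : rnorm (z * w) = rnorm z * rnorm w.
Proof. exact: rnormZ. Qed.

Lemma rnorm1 : rnorm (1 : C) = 1.
Proof. by apply: complexI; rewrite rnormE normr1. Qed.

Lemma rnormX z k : rnorm (z ^+ k) = rnorm z ^+ k.
Proof. by elim: k => [|k IH]; rewrite ?rnorm1// !exprS rnormM IH. Qed.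

Lemma rnormV z : rnorm z^-1 = (rnorm z)^-1.
Proof.
by apply: complexI; rewrite rnormE normfV -rnormE fmorphV.
Qed.

Lemma rnorm_real (x : R) : rnorm (x%:C : C) = `|x|.
Proof. by rewrite /rnorm normc_def /= expr0n /= addr0 sqrtr_sqr. Qed.

Lemma rnorm_i : rnorm ('i%C : C) = 1.
Proof. by rewrite /rnorm normc_def /= expr0n /= add0r expr1n sqrtr1. Qed.

Lemma sqr_rnorm z : rnorm z ^+ 2 = complex.Re z ^+ 2 + complex.Im z ^+ 2.
Proof.
by rewrite /rnorm normc_def /= sqr_sqrtr// addr_ge0// sqr_ge0.
Qed.

Lemma ler_Re_rnorm z : `|complex.Re z| <= rnorm z.
Proof. by rewrite -lecR rnormE; exact: normc_ge_Re. Qed.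

Lemma Re_le_rnorm z : complex.Re z <= rnorm z.
Proof. exact: le_trans (ler_norm _) (ler_Re_rnorm z). Qed.

Lemma Re_lip z w : `|complex.Re z - complex.Re w| <= rnorm (z - w).
Proof. by have := ler_Re_rnorm (z - w); rewrite raddfB. Qed.

Lemma rnorm_eq0 z : (rnorm z == 0) = (z == 0).
Proof.
by apply/eqP/eqP => [h|->]; [apply/eqP; rewrite -normr_eq0 -rnormE h|rewrite rnorm0].
Qed.

Lemma rnorm_le_ReIm z : rnorm z <= `|complex.Re z| + `|complex.Im z|.
Proof.
rewrite {1}(complexE z) (le_trans (rnormD _ _))// rnormM rnorm_i mul1r.
by rewrite !rnorm_real.
Qed.

Lemma in_closed_disc (a z : C) (r : R) : closed_disc a r z = (rnorm (z - a) <= r) :> Prop.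
Proof. by rewrite /closed_disc /= lec_rnorm. Qed.

Lemma in_open_disc (a z : C) (r : R) : open_disc a r z = (rnorm (z - a) < r) :> Prop.
Proof. by rewrite /open_disc /= ltc_rnorm. Qed.

Lemma in_disc_boundary (a z : C) (r : R) :
  disc_boundary a r z <-> rnorm (z - a) = r.
Proof.
rewrite /disc_boundary /= -rnormE; split => [/complexI//|-> //].
Qed.

Section Continuity.
Variables (V : normedModType C).

Lemma cvg_rnorm (W : normedModType C) (f : V -> W) (u : V) :
  (forall e : R, 0 < e -> exists2 d : R, 0 < d &
     forall v, rnorm (v - u) < d -> rnorm (f v - f u) < e) ->
  {for u, continuous f}.
Proof.
move=> h P /nbhs_rnorm[e e0 eP]; have [d d0 dP] := h e e0.
by apply/nbhs_rnorm; exists d => // v /dP /eP.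
Qed.

Lemma continuity_for_rnorm (W : normedModType C) (f : V -> W) (u : V) (e : R) :
  {for u, continuous f} -> 0 < e ->
  exists2 d : R, 0 < d & forall v, rnorm (v - u) < d -> rnorm (f v - f u) < e.
Proof.
move=> cf e0; have B : nbhs (f u) [set y | rnorm (y - f u) < e].
  by apply/nbhs_rnorm; exists e.
by have /nbhs_rnorm := cf _ B.
Qed.

Lemma cvg_rnormR (f : V -> R) (u : V) :
  (forall e : R, 0 < e -> exists2 d : R, 0 < d &
     forall v, rnorm (v - u) < d -> `|f v - f u| < e) ->
  {for u, continuous f}.
Proof.
move=> h; apply/cvgrPdist_lt => e e0; have [d d0 dP] := h e e0.
by apply/nbhs_rnorm; exists d => // v /dP; rewrite distrC.
Qed.

Lemma within_rnormP (K : set V) (f : V -> R) :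
  {within K, continuous f} <-> forall u, K u -> forall e : R, 0 < e ->
    exists2 d : R, 0 < d & forall v, K v -> rnorm (v - u) < d -> `|f v - f u| < e.
Proof.
rewrite subspace_continuousP; split => h u Ku.
  move=> e e0; move/cvgrPdist_lt : (h u Ku) => /(_ e e0) /nbhs_rnorm[d d0 dP].
  by exists d => // v Kv vu; rewrite distrC; exact: dP.
apply/cvgrPdist_lt => e e0; have [d d0 dP] := h u Ku e e0.
by apply/nbhs_rnorm; exists d => // v vu Kv; rewrite distrC; exact: dP.
Qed.

Lemma rnorm_continuous : continuous (@rnorm V).
Proof.
move=> u; apply: cvg_rnormR => e e0; exists e => // v h.
exact: le_lt_trans (rnorm_lip _ _) h.
Qed.

End Continuity.

Lemma Re_continuous : continuous (fun z : C => complex.Re z).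
Proof.
move=> u; apply: cvg_rnormR => e e0; exists e => // v h.
exact: le_lt_trans (Re_lip _ _) h.
Qed.

Lemma polyC_derivable (p : {poly C}) (z : C) : derivable (horner p) z (1 : C).
Proof.
elim/poly_ind: p => [|p c ih].
  have -> : horner (0 : {poly C}) = cst 0 by apply/funext => y; rewrite horner0.
  exact: derivable_cst.
have -> : horner (p * 'X + c%:P) = (horner p * id) + cst c.
  by apply/funext => y; rewrite hornerMXaddC.
apply: derivableD; last exact: derivable_cst.
apply: derivableM; [exact: ih|exact: derivable_id].
Qed.

Lemma polyC_continuous (p : {poly C}) : continuous (fun z : C => p.[z]).
Proof.
elim/poly_ind: p => [|p c ih] z.
  have -> : horner (0 : {poly C}) = cst 0 by apply/funext => y; rewrite horner0.
  exact: cst_continuous.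
have -> : horner (p * 'X + c%:P) = (horner p * id) + cst c.
  by apply/funext => y; rewrite hornerMXaddC.
apply: continuousD; last exact: cst_continuous.
by apply: continuousM; [exact: ih|move=> ?].
Qed.

(** The disc is closed and lies in the image of the square [-r, r] x [-r, r] under the continuous
    map (x, y) -> x + iy. *)
Lemma compact_rnorm_le (r : R) : compact [set z : C | rnorm z <= r].
Proof.
pose g (x : R * R) : C := x.1%:C + 'i%C * x.2%:C.
have cg : continuous g.
  move=> [x y] P /nbhs_rnorm[e e0 eP].
  exists (ball x (e / 2), ball y (e / 2)).
    by split; apply: nbhsx_ballx; rewrite divr_gt0.
  move=> [x' y'] [/= h1 h2]; apply: eP.
  apply: le_lt_trans (rnorm_le_ReIm _) _; rewrite /ball /= in h1 h2.
  rewrite (_ : g _ - g _ = (x' - x) +i* (y' - y)); last by rewrite /g /=; simpc.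
  by rewrite /= (distrC x') (distrC y'); lra.
have cK : compact (g @` (`[-r, r]%classic `*` `[-r, r]%classic)).
  apply: continuous_compact; first exact: continuous_subspaceT.
  by apply: compact_setX; exact: segment_compact.
apply: subclosed_compact cK _.
  rewrite (_ : [set z | _] = (@rnorm C) @^-1` [set x | x <= r]) //.
  by apply: closed_comp; [move=> ? _; exact: rnorm_continuous | exact: closed_le].
move=> z /= zr; exists (complex.Re z, complex.Im z); last by rewrite /g /= -complexE.
have hI : `|complex.Im z| <= rnorm z.
  by rewrite -ler_sqr ?nnegrE ?rnorm_ge0// sqr_rnorm real_normK ?num_real// lerDr sqr_ge0.
split; rewrite /= in_itv /= -ler_norml; apply: le_trans zr => //.
exact: ler_Re_rnorm.
Qed.

Lemma closed_disc_compact (a : C) (r : R) : compact (closed_disc a r).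
Proof.
rewrite (_ : closed_disc a r = (fun z => z + a) @` [set z : C | rnorm z <= r]).
  apply: continuous_compact; last exact: compact_rnorm_le.
  apply: continuous_subspaceT => z; apply: cvg_rnorm => e e0; exists e => // v.
  by rewrite opprD addrACA subrr addr0.
apply/seteqP; split => z; rewrite in_closed_disc.
  by move=> h; exists (z - a) => //; rewrite subrK.
by move=> [w /= h <-]; rewrite addrK.
Qed.

End RealNorm.

(** * The minimum principle *)

(** The mean value theorem for [g s + g (- s) - L * s ^+ 2] on [0, t] gives t times its derivative
    at some c in (0, t). Expanding [G] to first order at 0, at the points c and -c, bounds that
    derivative by e c. *)
Lemma symmetric_second_difference (R : realType) (g G : R -> R) (L eta : R) :
  0 < eta -> (forall t, `|t| < eta -> is_derive t (1 : R) g (G t)) ->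
  is_derive (0 : R) (1 : R) G L ->
  forall e, 0 < e -> exists2 d, 0 < d &
    forall t, 0 < t -> t < d -> `|g t + g (- t) - 2 * g 0 - L * t ^+ 2| <= e * t ^+ 2.
Proof.
move=> eta0 dg dG e e0.
have : \forall h \near 0^', `|L - h^-1 * (G h - G 0)| < e / 2.
  have e20 : 0 < e / 2 by rewrite divr_gt0.
  have := @ex_derive _ _ _ _ _ _ _ dG; rewrite /derivable => /cvgrPdist_lt /(_ _ e20).
  rewrite -/(derive G 0 1) derive_val; apply: filterS => h.
  by rewrite /= [_%:A]mulr1 addr0.
move=> [/= d d0 dP].
exists (Num.min d eta); first by rewrite lt_min d0.
move=> t t0; rewrite lt_min => /andP[td teta].
have GP s : 0 < `|s| -> `|s| < d -> `|G s - G 0 - L * s| <= e / 2 * `|s|.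
  move=> s0 sd; have sn0 : s != 0 by rewrite -normr_gt0.
  have := dP s; rewrite /= sub0r normrN => /(_ sd sn0) /ltW h.
  rewrite (_ : G s - _ - _ = - ((L - s^-1 * (G s - G 0)) * s)); last by field.
  by rewrite normrN normrM ler_wpM2r.
pose k s := g s + g (- s) - L * s ^+ 2.
have dk s : `|s| < eta -> is_derive s (1:R) k (G s - G (- s) - 2 * L * s).
  move=> s1; have d1 := dg _ s1.
  have d2 : is_derive (- s) (1 : R) g (G (- s)) by apply: dg; rewrite normrN.
  rewrite /k; apply: trigger_derive.
  rewrite /GRing.scale /= /GRing.scale /=; ring.
have [||c] := @MVT _ k (fun s => G s - G (- s) - 2 * L * s) 0 t t0.
- move=> s; rewrite in_itv /= => /andP[s0 st]; apply: dk.
  by rewrite gtr0_norm// (lt_trans st).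
- apply: derivable_within_continuous => s; rewrite in_itv /= => /andP[s0 st].
  have := dk s; rewrite ger0_norm// => /(_ (le_lt_trans st teta)) [] //.
rewrite in_itv /= => /andP[c0 ct].
rewrite /k oppr0 expr0n /= mulr0 ?oppr0 ?subr0 ?addr0 => kE.
rewrite (_ : g t + _ - _ - _ = (G c - G (- c) - 2 * L * c) * t); last first.
  by rewrite -kE; ring.
have h1 := GP c; have h2 := GP (- c); rewrite normrN (gtr0_norm c0) in h1 h2.
have {}h1 := h1 c0 (lt_trans ct td); have {}h2 := h2 c0 (lt_trans ct td).
rewrite normrM (gtr0_norm t0) expr2 mulrA ler_pM2r//.
have -> : G c - G (- c) - 2 * L * c = (G c - G 0 - L * c) - (G (- c) - G 0 - L * - c) by ring.
apply: le_trans (ler_normB _ _) _; apply: le_trans (lerD h1 h2) _.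
by rewrite -mulrDl -splitr ler_pM2l// ltW.
Unshelve. all: by end_near. Qed.

Lemma is_derive_translate (R : realType) (F : R -> R) (t : R) :
  derivable (fun s => F (t + s)) 0 (1 : R) ->
  is_derive t (1 : R) F (derive1 (fun s => F (t + s)) 0).
Proof.
have E : (fun h : R => h^-1 *: (F (t + (h *: 1 + 0)) - F (t + 0))) =
         (fun h : R => h^-1 *: (F (h *: 1 + t) - F t)).
  by apply/funext => h; rewrite !addr0 (addrC t).
move=> dF; split; first by move: dF; rewrite /derivable E.
by rewrite derive1E /derive E.
Qed.

Section MinimumPrinciple.
Variable R : realType.
Local Notation C := (Cplx R).
Implicit Types (u : C -> R) (z a : C).

(** The five-point stencil of step [t], not divided by [t ^+ 2]. The increments keep the form
    [z + v * t%:C] used for partial derivatives. *)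
Definition discrete_laplacian u z (t : R) : R :=
  u (z + 1 * t%:C) + u (z + 1 * (- t)%:C) +
  (u (z + 'i%C * t%:C) + u (z + 'i%C * (- t)%:C)) - 4 * u z.

(* A substitute for harmonicity at a point that needs no derivatives and
   is shared by C^2 harmonic functions and real parts of polynomials. *)
Definition flat u z : Prop := forall e : R, 0 < e ->
  exists2 d : R, 0 < d &
    forall t : R, 0 < t -> t < d -> `|discrete_laplacian u z t| <= e * t ^+ 2.

Lemma flatB u v z : flat u z -> flat v z -> flat (fun w => u w - v w) z.
Proof.
move=> fu fv e e0; have e20 : 0 < e / 2 by rewrite divr_gt0.
have [d1 d10 h1] := fu _ e20; have [d2 d20 h2] := fv _ e20.
exists (Num.min d1 d2); first by rewrite lt_min d10.
move=> t t0; rewrite lt_min => /andP[td1 td2].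
have -> : discrete_laplacian (fun w => u w - v w) z t =
  discrete_laplacian u z t - discrete_laplacian v z t.
  rewrite /discrete_laplacian; ring.
apply: le_trans (ler_normB _ _) _; apply: le_trans (lerD (h1 t t0 td1) (h2 t t0 td2)) _.
by rewrite -mulrDl -splitr.
Qed.

Lemma poly_bounded_unit_disc (p : {poly C}) :
  exists M : R, forall h, rnorm h <= 1 -> rnorm p.[h] <= M.
Proof.
elim/poly_ind: p => [|p c [M h]]; first by exists 0 => h _; rewrite horner0 rnorm0.
exists (M + rnorm c) => w w1; rewrite hornerMXaddC (le_trans (rnormD _ _))// lerD2r.
by rewrite rnormM -[leRHS]mulr1 ler_pM ?rnorm_ge0 ?h.
Qed.

Lemma polyMXaddC_ex (p : {poly C}) : exists q (c : C), p = q * 'X + c%:P.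
Proof.
elim/poly_ind: p => [|p c _]; last by exists p, c.
by exists 0, 0; rewrite mul0r addr0.
Qed.

(** In the Taylor expansion of [p] at [z], the stencil cancels the constant term, the linear term by
    symmetry, and the quadratic term because 1 + i^2 = 0. What remains is of order t^3. *)
Lemma flat_Re_poly (p : {poly C}) z : flat (fun w => complex.Re p.[w]) z.
Proof.
have [p1 [c0 E0]] := polyMXaddC_ex (p \Po ('X + z%:P)).
have [p2 [c1 E1]] := polyMXaddC_ex p1.
have [s [c2 E2]] := polyMXaddC_ex p2.
have pE h : p.[z + h] = h ^+ 3 * s.[h] + c2 * h ^+ 2 + c1 * h + c0.
  have : (p \Po ('X + z%:P)).[h] = p.[z + h].
    by rewrite horner_comp hornerD hornerX hornerC addrC.
  by move=> <-; rewrite E0 E1 E2 !hornerMXaddC; ring.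
have [M sM] := poly_bounded_unit_disc s.
have M0 : 0 <= M by rewrite (le_trans (rnorm_ge0 _) (sM 0 _))// rnorm0.
(* The bound 1 keeps the increments in the disc where [M] bounds [s]. The other one makes the four
   cubic remainders, at most 4 M t^3 together, smaller than e t^2; [M + 1] avoids a division by
   zero. *)
move=> e e0; exists (Num.min 1 (e / (4 * (M + 1)))).
  by rewrite lt_min ltr01 /= divr_gt0// mulr_gt0// ltr_wpDl.
move=> t t0; rewrite lt_min => /andP[t1 td].
have i2 : 'i%C * 'i%C = -1 :> C by rewrite -expr2 sqr_i.
rewrite /discrete_laplacian -{5}[z]addr0 !pE.
set T : C := t%:C; rewrite rmorphN /= -/T.
have ReE (x1 x2 x3 x4 x5 : C) : complex.Re x1 + complex.Re x2 +
    (complex.Re x3 + complex.Re x4) - 4 * complex.Re x5 =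
    complex.Re (x1 + x2 + (x3 + x4) - (x5 + x5 + (x5 + x5))).
  by rewrite !(raddfB, raddfD) /=; ring.
rewrite {}ReE.
set I := 'i%C in i2 *.
have -> (y1 y2 y3 y4 y0 : C) : (1 * T) ^+ 3 * y1 + c2 * (1 * T) ^+ 2 + c1 * (1 * T) + c0 +
  ((1 * - T) ^+ 3 * y2 + c2 * (1 * - T) ^+ 2 + c1 * (1 * - T) + c0) +
  ((I * T) ^+ 3 * y3 + c2 * (I * T) ^+ 2 + c1 * (I * T) + c0 +
   ((I * - T) ^+ 3 * y4 + c2 * (I * - T) ^+ 2 + c1 * (I * - T) + c0)) -
  (0 ^+ 3 * y0 + c2 * 0 ^+ 2 + c1 * 0 + c0 + (0 ^+ 3 * y0 + c2 * 0 ^+ 2 + c1 * 0 + c0) +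
  (0 ^+ 3 * y0 + c2 * 0 ^+ 2 + c1 * 0 + c0 + (0 ^+ 3 * y0 + c2 * 0 ^+ 2 + c1 * 0 + c0))) =
  (1 * T) ^+ 3 * y1 + (1 * - T) ^+ 3 * y2 +
  ((I * T) ^+ 3 * y3 + (I * - T) ^+ 3 * y4) by ring: i2.
have b (h : C) : rnorm h = t -> rnorm (h ^+ 3 * s.[h]) <= M * t ^+ 3.
  move=> ht; rewrite rnormM rnormX ht mulrC ler_wpM2r ?exprn_ge0 ?(ltW t0)//.
  by rewrite sM// ht ltW.
have rT : rnorm T = t by rewrite rnorm_real gtr0_norm.
apply: le_trans (ler_Re_rnorm _) _.
apply: le_trans (rnormD _ _) _.
apply: le_trans (lerD (rnormD _ _) (rnormD _ _)) _.
apply: le_trans (lerD (lerD (b _ _) (b _ _)) (lerD (b _ _) (b _ _))) _;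
  rewrite ?rnormM ?rnormN ?rnorm1 ?rnorm_i ?mul1r//.
rewrite -[in leRHS]mulrC [t ^+ 3]exprSr.
have h : 4 * (M + 1) * t <= e.
  by rewrite mulrC -ler_pdivlMr ?ltW// mulr_gt0// ltr_wpDl.
have t2 : 0 <= t ^+ 2 by rewrite exprn_ge0// ltW.
have := ler_wpM2l t2 h.
have : 0 <= t ^+ 2 * t by rewrite mulr_ge0// ltW.
lra.
Qed.

(** The stencil is the sum of the symmetric second differences along the two axes, and the two
    second derivatives that they approximate cancel. *)
Lemma flat_harmonic (D : set C) (phi : C -> R) z :
  open D -> D z -> harmonic_on D phi -> flat phi z.
Proof.
move=> oD Dz [[C1 C11 C1i] lap0].
have line (v : C) : rnorm v = 1 -> (v = 1 \/ v = 'i%C) -> C1_on D (partial v phi) ->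
  forall e, 0 < e -> exists2 d, 0 < d &
    forall t, 0 < t -> t < d -> `|phi (z + v * t%:C) + phi (z + v * (- t)%:C) - 2 * phi z
       - partial v (partial v phi) z * t ^+ 2| <= e * t ^+ 2.
  move=> v1 hv C1v e e0.
  have /nbhs_rnorm[eta eta0 etaP] := open_nbhs_nbhs (conj oD Dz).
  have inD t : `|t| < eta -> D (z + v * t%:C).
    by move=> te; apply: etaP; rewrite addrAC subrr add0r rnormM v1 mul1r rnorm_real.
  have lineE (u : C -> R) t : (fun s => u (z + v * (t + s)%:C)) =
                              (fun s => u (z + v * t%:C + v * s%:C)).
    by apply/funext => s; rewrite rmorphD /= mulrDr addrA.
  have [t te||d d0 dP] := @symmetric_second_difference R (fun t => phi (z + v * t%:C))
    (fun t => partial v phi (z + v * t%:C)) (partial v (partial v phi) z) eta eta0 _ _ e e0.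
  - have := @is_derive_translate R (fun t => phi (z + v * t%:C)) t.
    rewrite lineE; apply; exact: ((C1 v hv).1 _ (inD t te)).
  - have := @is_derive_translate R (fun t => partial v phi (z + v * t%:C)) 0.
    rewrite lineE mulr0 addr0; apply; exact: ((C1v v hv).1 _ Dz).
  by exists d => // t t0 /(dP t t0); rewrite mulr0 addr0.
move=> e e0; have e20 : 0 < e / 2 by rewrite divr_gt0.
have [d1 d10 h1] := line 1 (rnorm1 R) (or_introl erefl) C11 _ e20.
have [d2 d20 h2] := line 'i%C (rnorm_i R) (or_intror erefl) C1i _ e20.
exists (Num.min d1 d2); first by rewrite lt_min d10.
move=> t t0; rewrite lt_min => /andP[/(h1 t t0) {}h1 /(h2 t t0) {}h2].
have := le_trans (ler_normD _ _) (lerD h1 h2).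
rewrite -mulrDl -splitr; apply: le_trans; rewrite le_eqVlt; apply/orP; left; apply/eqP.
congr (`| _ |); have /eqP := lap0 z Dz; rewrite addr_eq0 => /eqP ->.
rewrite /discrete_laplacian; ring.
Qed.

(** If [u] is negative somewhere inside, adding a small strictly superharmonic [q] that vanishes on
    the circle still leaves a negative interior minimum. There the stencil of [u + q] is
    nonnegative, while that of [q] is -4 eps t^2; so the stencil of [u] is at least 4 eps t^2,
    against flatness. *)
Lemma minimum_principle u a (r : R) :
  {within closed_disc a r, continuous u} ->
  (forall z, open_disc a r z -> flat u z) ->
  (forall z, disc_boundary a r z -> 0 <= u z) ->
  forall z, open_disc a r z -> 0 <= u z.
Proof.
move=> cu fu bu z0; rewrite in_open_disc => z0r; rewrite leNgt; apply/negP => uz0.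
have r0 : 0 < r by rewrite (le_lt_trans (rnorm_ge0 _) z0r).
(* With this value [q] is at most [- u z0 / 2], so the sum stays negative at [z0]. *)
pose eps := - u z0 / (2 * r ^+ 2).
have eps0 : 0 < eps by rewrite divr_gt0 ?oppr_gt0// mulr_gt0// exprn_gt0.
pose q (z : C) := eps * (r ^+ 2 - rnorm (z - a) ^+ 2).
have cq : continuous q.
  have cN : continuous (fun z : C => rnorm (z - a)).
    move=> z; apply: cvg_rnormR => e e0; exists e => // w wz.
    by apply: le_lt_trans (rnorm_lip _ _) _; rewrite opprB addrA subrK.
  have -> : q = (fun x => eps * (r ^+ 2 - x ^+ 2)) \o (fun z => rnorm (z - a)) by [].
  move=> z; apply: continuous_comp; first exact: cN.
  apply: cvgM; first exact: cvg_cst.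
  by apply: cvgB; [exact: cvg_cst|exact: exprn_continuous].
have cv : {within closed_disc a r, continuous (fun z => u z + q z)}.
  by apply: within_continuousD => //; exact: continuous_subspaceT.
have aD : closed_disc a r a by rewrite in_closed_disc subrr rnorm0 ltW.
have D0 : closed_disc a r !=set0 by exists a.
have [z1 /set_mem] := compact_EVT_min D0 (@closed_disc_compact _ a r) cv.
rewrite in_closed_disc => z1D z1min.
have qz0 : u z0 + q z0 < 0.
  apply: (@le_lt_trans _ _ (u z0 + eps * r ^+ 2)).
    by rewrite lerD2l ler_pM2l// gerBl exprn_ge0// rnorm_ge0.
  have -> : eps * r ^+ 2 = - u z0 / 2 by rewrite /eps; field; rewrite gt_eqF.
  by lra.
have v1 : u z1 + q z1 < 0.
  by apply: le_lt_trans qz0; apply: z1min; rewrite inE in_closed_disc ltW.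
have z1r : rnorm (z1 - a) < r.
  rewrite lt_neqAle z1D andbT; apply/eqP => /in_disc_boundary /[dup] /bu u1.
  by move=> /in_disc_boundary h; move: v1; rewrite /q h subrr mulr0 addr0 ltNge u1.
have [d d0 dP] := fu z1 (eq_ind_r id z1r (in_open_disc a z1 r)) _ eps0.
(* The first bound makes flatness applicable, the second keeps the four stencil points in the closed
   disc. *)
pose t := Num.min (d / 2) (r - rnorm (z1 - a)).
have t0 : 0 < t by rewrite lt_min divr_gt0//= subr_gt0.
have tr : rnorm (z1 - a) + t <= r by rewrite -lerBrDl ge_min lexx orbT.
have td : t < d by rewrite gt_min ltr_pdivrMr// ltr_pMr// ltr1n.
have {}dP := dP t t0 td.
have min1 (w : C) : rnorm w = t -> u z1 + q z1 <= u (z1 + w) + q (z1 + w).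
  move=> wt; apply: z1min; rewrite inE in_closed_disc addrAC.
  by apply: le_trans (rnormD _ _) _; rewrite wt.
have m1 := min1 (1 * t%:C); have m2 := min1 (1 * (- t)%:C).
have m3 := min1 ('i%C * t%:C); have m4 := min1 ('i%C * (- t)%:C).
rewrite !rnormM rnorm1 rnorm_i !mul1r !rnorm_real normrN gtr0_norm// in m1 m2 m3 m4.
have {}m1 := m1 erefl; have {}m2 := m2 erefl.
have {}m3 := m3 erefl; have {}m4 := m4 erefl.
have lapq : discrete_laplacian q z1 t = - 4 * eps * t ^+ 2.
  rewrite /discrete_laplacian /q !sqr_rnorm.
  case: (z1) (a) => [x y] [b c] /=; simpc; rewrite /=; ring.
have : discrete_laplacian u z1 t >= 4 * eps * t ^+ 2.
  move: lapq m1 m2 m3 m4; rewrite /discrete_laplacian !mul1r; lra.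
move/(le_trans (ler_norm _)) : dP => dP /le_trans /(_ dP).
have : 0 < eps * t ^+ 2 by rewrite mulr_gt0// exprn_gt0.
lra.
Qed.

End MinimumPrinciple.

(** * Approximation on circles by real parts of polynomials *)

Section CircleApproximation.
Variable R : realType.
Local Notation C := (Cplx R).
Implicit Types z w a : C.

(** Over the algebraically closed field, 'X^M - 1 splits into M distinct factors, and M distinct
    M-th roots of unity must include a primitive one. *)
Lemma primitive_root_exists M : (0 < M)%N -> exists w : C, M.-primitive_root w.
Proof.
move=> M0; have p0 : 'X^M - 1 != 0 :> {poly R[i]} by rewrite -size_poly_eq0 size_XnsubC.
have [r Dp] := closed_field_poly_normal ('X^M - 1 : {poly R[i]}).
rewrite lead_coefXnsubC// scale1r in Dp.
have rn1 : all M.-unity_root r by apply/allP => z; rewrite -root_prod_XsubC -Dp.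
have sz_r : (M < (size r).+1)%N by rewrite -(size_prod_XsubC r id) -Dp size_XnsubC.
have [|z] := hasP (has_prim_root M0 rn1 _ sz_r); last by exists z.
by rewrite -separable_prod_XsubC -Dp separable_Xn_sub_1// pnatr_eq0 -lt0n.
Qed.

Lemma sum_primitive_root (w : C) M e : M.-primitive_root w ->
  \sum_(k < M) (w ^+ k) ^+ e = if (M %| e)%N then M%:R else 0.
Proof.
move=> wM; case: ifPn => [|Me].
  rewrite (prim_order_dvd wM) => /eqP we; rewrite (eq_bigr (fun=> 1)).
    by rewrite sumr_const card_ord.
  by move=> k _; rewrite exprAC we expr1n.
have we : w ^+ e - 1 != 0 by rewrite subr_eq0 -(prim_order_dvd wM).
apply: (mulfI we); rewrite mulr0.
rewrite (eq_bigr (fun k : 'I_M => (w ^+ e) ^+ k)); last by move=> k _; rewrite exprAC.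
by rewrite -subrX1 exprAC (prim_expr_order wM) expr1n subrr.
Qed.

Lemma unit_circle_neq0 z : rnorm z = 1 -> z != 0.
Proof. by move=> z1; rewrite -rnorm_eq0 z1 oner_eq0. Qed.

Lemma sqr_rnorm_conj z : (rnorm z ^+ 2)%:C = z * z^*%C.
Proof. by rewrite rmorphXn /= rnormE; exact: sqr_normc. Qed.

Lemma unit_circle_conj z : rnorm z = 1 -> z^*%C = z^-1.
Proof.
move=> z1; apply: (mulfI (unit_circle_neq0 z1)).
by rewrite -sqr_rnorm_conj z1 expr1n mulfV ?unit_circle_neq0.
Qed.

Lemma rnorm_primitive_root (w : C) M : (0 < M)%N -> M.-primitive_root w -> rnorm w = 1.
Proof.
move=> M0 wM; have : rnorm w ^+ M = 1 by rewrite -rnormX (prim_expr_order wM) rnorm1.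
by move=> /eqP; rewrite pexpr_eq1// ?rnorm_ge0// => /eqP.
Qed.

(** Conjugation is inversion on the unit circle, so the squared modulus becomes a Laurent
    polynomial, to which sums over roots of unity apply. *)
Lemma sqr_rnormD_circle z w : rnorm z = 1 -> rnorm w = 1 ->
  (rnorm (z + w) ^+ 2)%:C = (z + w) ^+ 2 / (z * w).
Proof.
move=> z1 w1; rewrite sqr_rnorm_conj rmorphD /= !unit_circle_conj//.
by field; rewrite !unit_circle_neq0.
Qed.

Lemma sqr_rnormB_circle z w : rnorm z = 1 -> rnorm w = 1 ->
  rnorm (z - w) ^+ 2 = 4 - rnorm (z + w) ^+ 2.
Proof.
move=> z1 w1; have : rnorm z ^+ 2 = 1 by rewrite z1 expr1n.
have : rnorm w ^+ 2 = 1 by rewrite w1 expr1n.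
rewrite !sqr_rnorm !raddfB !raddfD /=; lra.
Qed.

(* On the unit circle [|z + w|^(2N)] is a trigonometric polynomial of degree [N]
   in [w], so summing it over the [M]-th roots of unity is exact for [N < M].
   With [|z - w|^2 = 4 - |z + w|^2] this also gives the second moment of the
   normalized kernel, which tends to 0: Korovkin's argument then yields uniform
   approximation without integrals. *)
Lemma kernel_sum N M (w z : C) : (N < M)%N -> M.-primitive_root w -> rnorm z = 1 ->
  \sum_(k < M) (rnorm (z + w ^+ k) ^+ 2) ^+ N = M%:R * 'C(N.*2, N)%:R.
Proof.
move=> NM wM z1; have M0 : (0 < M)%N by case: M NM {wM}.
have w1 := rnorm_primitive_root M0 wM.
have z0 := unit_circle_neq0 z1; have w0 := unit_circle_neq0 w1.
apply: complexI; rewrite rmorph_sum rmorphM !rmorph_nat /=.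
(* The exponent [i + (M - N)] stands for i - N: adding M changes nothing for an M-th root of unity
   and keeps the exponent a natural number. *)
have E (k : 'I_M) : ((rnorm (z + w ^+ k) ^+ 2) ^+ N)%:C =
    \sum_(i < N.*2.+1) (z ^- N * z ^+ (N.*2 - i) *+ 'C(N.*2, i)) * (w ^+ k) ^+ (i + (M - N)).
  rewrite rmorphXn /= sqr_rnormD_circle ?rnormX ?w1 ?expr1n//.
  rewrite expr_div_n -exprM mul2n exprMn exprDn mulr_suml; apply: eq_bigr => i _.
  have -> : (w ^+ k) ^+ (i + (M - N)) = (w ^+ k) ^+ i * (w ^+ k) ^- N.
    have u : w ^+ k \is a GRing.unit by rewrite unitfE expf_neq0.
    by rewrite exprD (exprB (ltnW NM) u) (exprAC w k M) (prim_expr_order wM) expr1n mul1r.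
  by rewrite invfM 2!mulrnAl mulrACA [X in X * _ *+ _]mulrC.
rewrite (eq_bigr _ (fun k _ => E k)) exchange_big /=.
have NN : (N < N.*2.+1)%N by lia.
(* Only i = N survives: i + M - N lies strictly between 0 and 2M, so it is a multiple of M only when
   it equals M. *)
rewrite (bigD1 (Ordinal NN))//= [X in _ + X]big1 ?addr0; last first.
  move=> i iN; rewrite -mulr_sumr sum_primitive_root// ifN ?mulr0//.
  apply/negP => /dvdnP[q qE]; move: iN; rewrite -val_eqE /= => iN.
  have := ltn_ord i; case: q qE => [|[|q]]; nia.
rewrite -mulr_sumr subnKC ?(ltnW NM)// sum_primitive_root// dvdnn.
have -> : (N.*2 - N)%N = N by lia.
by rewrite mulVf ?expf_neq0// -mulr_natl mulr1 mulrC.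
Qed.

Lemma central_binomialS N :
  (N.+1%:R * 'C(N.+1.*2, N.+1)%:R = 2 * (N.*2.+1%:R * 'C(N.*2, N)%:R) :> R).
Proof.
rewrite -!natrM; congr (_%:R).
have h1 := mul_bin_diag N.+1.*2 N; have h2 := mul_bin_down N.*2.+1 N.
rewrite doubleS /= in h1 h2 *.
have E : (N.*2.+1 - N = N.+1)%N by lia.
rewrite E in h2.
nia.
Qed.

(** The moment is 4 times the kernel sum of order N minus that of order N + 1, hence the bound on M.
    The ratio of consecutive central binomials then gives 4 - 2(2N+1)/(N+1) = 2/(N+1). *)
Lemma kernel_moment N M (w z : C) : (N.+1 < M)%N -> M.-primitive_root w -> rnorm z = 1 ->
  \sum_(k < M) (rnorm (z + w ^+ k) ^+ 2) ^+ N * rnorm (z - w ^+ k) ^+ 2 =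
  M%:R * 'C(N.*2, N)%:R * (2 / N.+1%:R).
Proof.
move=> NM wM z1; have M0 : (0 < M)%N by case: M NM {wM}.
have w1 := rnorm_primitive_root M0 wM.
transitivity (\sum_(k < M) (4 * (rnorm (z + w ^+ k) ^+ 2) ^+ N -
                          (rnorm (z + w ^+ k) ^+ 2) ^+ N.+1)).
  apply: eq_bigr => k _; rewrite sqr_rnormB_circle ?rnormX ?w1 ?expr1n//.
  by rewrite (exprSr (rnorm (z + w ^+ k) ^+ 2)); ring.
rewrite sumrB -mulr_sumr !kernel_sum// ?(ltnW NM)//.
have N0 : N.+1%:R != 0 :> R by rewrite pnatr_eq0.
apply: (mulfI N0).
have := central_binomialS N; set c1 := 'C(_, _)%:R; set c := 'C(_, _)%:R => h.
transitivity (M%:R * (4 * N.+1%:R * c - N.+1%:R * c1)); first by ring.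
rewrite h; have -> : N.*2.+1%:R = 2 * N.+1%:R - 1 :> R.
  by rewrite -[N.*2]muln2 -!natr1 natrM; ring.
by field.
Qed.

(** On the unit circle a negative power can be reflected: c z^-k and conj(c) z^k are conjugate, so
    they have the same real part. The induction peels off the constant coefficient of [Q], which
    carries the most negative power. *)
Lemma circle_trig_poly (Q : {poly C}) N :
  exists P : {poly C}, forall z, rnorm z = 1 ->
    complex.Re P.[z] = complex.Re (z ^- N * Q.[z]).
Proof.
elim/poly_ind: Q N => [|Q c IH] N; first by exists 0 => z _; rewrite !horner0 mulr0.
case: N => [|N]; first by exists (Q * 'X + c%:P) => z _; rewrite expr0 invr1 mul1r.
have [P PE] := IH N; exists (P + (c^*%C : C)%:P * 'X^(N.+1)) => z z1.
have z0 := unit_circle_neq0 z1.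
rewrite hornerD hornerM hornerC hornerXn hornerMXaddC mulrDr !raddfD /= PE//.
congr (complex.Re _ + _); first by rewrite exprSr invfM; field; rewrite expf_neq0 z0.
have -> (x : C) : complex.Re x = complex.Re x^*%C by case: x.
by rewrite rmorphM /= rmorphXn /= conjcK unit_circle_conj// mulrC exprVn.
Qed.

(** Heine-Cantor, through the near-covering form of compactness applied to the filter of radii
    tending to 0 from the right. *)
Lemma compact_uniform_continuous (K : set C) (psi : C -> R) (e : R) :
  compact K -> {within K, continuous psi} -> 0 < e ->
  exists2 d : R, 0 < d & forall z w, K z -> K w -> rnorm (w - z) < d ->
    `|psi w - psi z| < e.
Proof.
move=> /compact_near_coveringP cK /within_rnormP cpsi e0.
have e20 : 0 < e / 2 by rewrite divr_gt0.
have [|d /= d0 dP] := cK R (0 : R)^'+ (fun d z => K z ->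
  forall w, K w -> rnorm (w - z) < d -> `|psi w - psi z| < e) _.
  move=> z Kz; have [d d0 dP] := cpsi z Kz _ e20.
  have d20 : 0 < d / 2 by rewrite divr_gt0.
  exists ([set z' : C | rnorm (z' - z) < d / 2], [set t : R | t < d / 2]).
    split; first by apply/nbhs_rnorm; exists (d / 2).
    exact: nbhs_right_lt.
  move=> [z' t] [/= z'd td] Kz' w Kw wz'.
  have h1 := dP z' Kz' _; have h2 := dP w Kw _.
  have -> : psi w - psi z' = (psi w - psi z) - (psi z' - psi z) by ring.
  apply: le_lt_trans (ler_normB _ _) _; rewrite [e]splitr ltrD//.
    by apply: h2; apply: le_lt_trans (rnorm_dist _ z' _) _; lra.
  by apply: h1; lra.
exists (d / 2); first by rewrite divr_gt0.
move=> z w Kz Kw zw; apply: (dP (d / 2)) => //=; last by rewrite divr_gt0.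
by rewrite sub0r normrN gtr0_norm ?divr_gt0// ltr_pdivrMr// ltr_pMr// ltr1n.
Qed.

(** The estimate that Korovkin's argument needs: pairs closer than the modulus d of uniform
    continuity cost at most [e], and for the others the oscillation of [psi] is at most itself times
    (|z - w|/d)^2. *)
Lemma circle_modulus (psi : C -> R) (e : R) :
  {within closed_disc 0 1, continuous psi} -> 0 < e ->
  exists2 B : R, 0 <= B & forall z w : C, rnorm z = 1 -> rnorm w = 1 ->
    `|psi w - psi z| <= e + B * rnorm (z - w) ^+ 2.
Proof.
move=> cpsi e0; have cK := @closed_disc_compact R 0 1.
have in1 (z : C) : rnorm z = 1 -> closed_disc 0 1 z.
  by rewrite in_closed_disc subr0 => ->.
have D0 : closed_disc (0 : C) (1 : R) !=set0 by exists 1; apply: in1; exact: rnorm1.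
have [d d0 dP] := compact_uniform_continuous cK cpsi e0.
have [zM _ hM] := compact_EVT_max D0 cK cpsi.
have [zm zmD hm] := compact_EVT_min D0 cK cpsi.
have D := hM zm zmD.
exists ((psi zM - psi zm) / d ^+ 2); first by rewrite divr_ge0 ?subr_ge0// exprn_ge0// ltW.
move=> z w /in1 z1 /in1 w1; have [zw|zw] := ltP (rnorm (w - z)) d.
  apply: le_trans (ltW (dP z w z1 w1 zw)) _.
  by rewrite lerDl mulr_ge0 ?exprn_ge0 ?rnorm_ge0// divr_ge0 ?subr_ge0// exprn_ge0// ltW.
rewrite rnormBC in zw.
apply: (@le_trans _ _ (psi zM - psi zm)).
  have h1 := hM z (mem_set z1); have h2 := hM w (mem_set w1).
  have h3 := hm z (mem_set z1); have h4 := hm w (mem_set w1).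
  by rewrite ler_norml; lra.
apply: (@le_trans _ _ ((psi zM - psi zm) / d ^+ 2 * rnorm (z - w) ^+ 2)); last by rewrite lerDr ltW.
rewrite mulrAC ler_pdivlMr ?exprn_gt0// ler_wpM2l ?subr_ge0//.
by rewrite ler_sqr ?nnegrE ?rnorm_ge0// ltW.
Qed.

(** The approximant is the average of the samples of [psi] at roots of unity, weighted by the
    normalized kernel. The error is at most e/2 plus [B] times the second moment 2/(N+1). *)
Lemma unit_circle_approx (psi : C -> R) (e : R) :
  {within closed_disc 0 1, continuous psi} -> 0 < e ->
  exists p : {poly C}, forall z, rnorm z = 1 -> `|complex.Re p.[z] - psi z| <= e.
Proof.
move=> cpsi e0; have e20 : 0 < e / 2 by rewrite divr_gt0.
have [B B0 BP] := circle_modulus cpsi e20.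
have [N NB] : exists N : nat, B * (2 / N.+1%:R) <= e / 2.
  exists (Num.bound (4 * B / e)).
  have N0 : 0 < (Num.bound (4 * B / e)).+1%:R :> R by rewrite ltr0n.
  have : 4 * B / e < (Num.bound (4 * B / e)).+1%:R.
    apply: (lt_trans (archi_boundP _)); last by rewrite ltr_nat.
    by rewrite divr_ge0 ?mulr_ge0// ltW.
  rewrite ltr_pdivrMr// mulrA ler_pdivrMr// => h.
  by rewrite mulrAC ler_pdivlMr//; lra.
(* N + 2 is the least number of nodes for which the second moment is exact. *)
have [w wM] := @primitive_root_exists N.+2 isT.
have w1 := rnorm_primitive_root (isT : (0 < N.+2)%N) wM.
(* The total mass of the kernel, independent of [z]. *)
pose c : R := N.+2%:R * 'C(N.*2, N)%:R.
have c0 : 0 < c by rewrite mulr_gt0// ltr0n// bin_gt0; lia.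
pose Q : {poly C} := \sum_(k < N.+2) (psi (w ^+ k) / c)%:C *:
   ((w ^+ k) ^- N *: ('X + (w ^+ k)%:P) ^+ N.*2).
have [p pE] := circle_trig_poly Q N.
exists p => z z1; rewrite pE// /Q horner_sum mulr_sumr raddf_sum /=.
pose K k := (rnorm (z + w ^+ k) ^+ 2) ^+ N.
have KE k : (K k)%:C = z ^- N * ((w ^+ k) ^- N * (z + w ^+ k) ^+ N.*2).
  rewrite rmorphXn /= sqr_rnormD_circle// ?rnormX ?w1 ?expr1n//.
  by rewrite expr_div_n -(exprM (z + w ^+ k) 2 N) mul2n exprMn invfM mulrC -mulrA.
rewrite (eq_bigr (fun k : 'I_N.+2 => psi (w ^+ k) / c * K k)); last first.
  move=> k _; rewrite !hornerZ horner_exp hornerD hornerX hornerC mulrCA -KE.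
  by rewrite -rmorphM.
have -> : psi z = \sum_(k < N.+2) psi z / c * K k.
  by rewrite -mulr_sumr kernel_sum// -/c mulfVK// gt_eqF.
rewrite -sumrB; apply: le_trans (ler_norm_sum _ _ _) _.
apply: (@le_trans _ _ (\sum_(k < N.+2)
  (e / 2 / c * K k + B / c * (K k * rnorm (z - w ^+ k) ^+ 2)))).
  apply: ler_sum => k _.
  have K0 : 0 <= K k by rewrite exprn_ge0// exprn_ge0// rnorm_ge0.
  have -> : psi (w ^+ k) / c * K k - psi z / c * K k = (psi (w ^+ k) - psi z) * (K k / c).
    by ring.
  have Kc0 : 0 <= K k / c by rewrite divr_ge0// ltW.
  rewrite normrM (ger0_norm Kc0).
  have wk1 : rnorm (w ^+ k) = 1 by rewrite rnormX w1 expr1n.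
  have := ler_wpM2r Kc0 (BP z (w ^+ k) z1 wk1).
  by move=> /le_trans; apply; rewrite le_eqVlt; apply/orP; left; apply/eqP; ring.
rewrite big_split /= -!mulr_sumr kernel_sum// kernel_moment// -/c.
have -> : e / 2 / c * c + B / c * (c * (2 / N.+1%:R)) = e / 2 + B * (2 / N.+1%:R).
  by field; rewrite nat1r (gt_eqF c0) pnatr_eq0.
by rewrite [leRHS]splitr lerD2l.
Qed.

Lemma circle_approx (phi : C -> R) a (r e : R) :
  0 < r -> {within closed_disc a r, continuous phi} -> 0 < e ->
  exists p : {poly C}, forall z, disc_boundary a r z ->
    phi z <= complex.Re p.[z] <= phi z + e.
Proof.
move=> r0 cphi e0; have e20 : 0 < e / 2 by rewrite divr_gt0.
pose psi (w : C) := phi (a + r%:C * w).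
have cpsi : {within closed_disc 0 1, continuous psi}.
  apply/within_rnormP => z; rewrite in_closed_disc subr0 => z1 d d0.
  have inD (w : C) : rnorm w <= 1 -> closed_disc a r (a + r%:C * w).
    by rewrite in_closed_disc addrAC subrr add0r rnormM rnorm_real gtr0_norm// ger_pMr.
  move/within_rnormP : cphi => /(_ _ (inD z z1) _ d0)[t t0 tP].
  exists (t / r); first by rewrite divr_gt0.
  move=> w; rewrite in_closed_disc subr0 => w1 wz; apply: tP; first exact: inD.
  rewrite opprD addrACA subrr add0r -mulrBr rnormM rnorm_real gtr0_norm//.
  by rewrite mulrC -ltr_pdivlMr.
have [p pP] := unit_circle_approx cpsi e20.
(* The shift by e/2 turns the two-sided error e/2 into an approximation from above. *)
exists (p \Po ((r^-1)%:C *: ('X - a%:P)) + (e / 2)%:C%:P) => z /in_disc_boundary zr.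
rewrite hornerD horner_comp hornerZ hornerD hornerN hornerX !hornerC raddfD /=.
set w := _ * _.
have w1 : rnorm w = 1.
  by rewrite rnormM zr rnorm_real gtr0_norm ?invr_gt0// mulVf// gt_eqF.
have wz : phi z = psi w.
  rewrite /psi mulrA -rmorphM /= mulfV ?gt_eqF// mul1r addrC subrK//.
have := pP w w1; rewrite wz ler_norml; lra.
Qed.

End CircleApproximation.

(** * Translated discs and the inradius *)

Section Inradius.
Variables (R : realType) (V : normedModType (Cplx R)) (U : set V).
Implicit Types (u v w : V) (t : R).

(* Truncating the boundary distance at 1 keeps it finite when [U] is the
   whole space. *)
Definition inradius_set v : set R :=
  [set t | 0 <= t <= 1 /\ forall w, rnorm (w - v) < t -> U w].

Definition inradius v : R := sup (inradius_set v).

Lemma has_sup_inradius_set v : has_sup (inradius_set v).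
Proof.
split; last by exists 1 => t [/andP[]].
exists 0; split; first by rewrite lexx ler01.
by move=> w; rewrite ltNge rnorm_ge0.
Qed.

Lemma le_inradius v t : 0 <= t <= 1 ->
  (forall w, rnorm (w - v) < t -> U w) -> t <= inradius v.
Proof. by move=> t01 tU; apply: sup_upper_bound; first exact: has_sup_inradius_set. Qed.

Lemma inradius_ge0 v : 0 <= inradius v.
Proof.
apply: le_inradius; first by rewrite lexx ler01.
by move=> w; rewrite ltNge rnorm_ge0.
Qed.

Lemma inradius_sub v w : rnorm (w - v) < inradius v -> U w.
Proof.
rewrite -subr_gt0 => h; have [t [_ tU]] := sup_adherent h (has_sup_inradius_set v).
by rewrite subKr; exact: tU.
Qed.

Lemma inradius_le1 v : inradius v <= 1.
Proof. by apply: ge_sup => [|t [/andP[]]//]; case: (has_sup_inradius_set v). Qed.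

(** A ball around one point contains the ball around another whose radius is smaller by their
    distance. *)
Lemma inradius_lip v w : `|inradius v - inradius w| <= rnorm (v - w).
Proof.
have lip v' w' : inradius v' - rnorm (v' - w') <= inradius w'.
  have [h|h] := leP (inradius v') (rnorm (v' - w')).
    by rewrite (@le_trans _ _ 0) ?subr_le0// inradius_ge0.
  apply: le_inradius.
    by have := inradius_le1 v'; have := rnorm_ge0 (v' - w'); lra.
  move=> u uw; apply: (@inradius_sub v'); rewrite (le_lt_trans (rnorm_dist u w' v'))//.
  by rewrite (rnormBC w'); lra.
have := lip v w; have := lip w v; rewrite (rnormBC w) ler_norml; lra.
Qed.

Lemma inradius_gt0 v : open U -> (0 < inradius v) <-> U v.
Proof.
move=> oU; split => [h|Uv].
  by apply: (@inradius_sub v); rewrite subrr rnorm0.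
have /nbhs_rnorm[e e0 eU] := open_nbhs_nbhs (conj oU Uv).
apply: (@lt_le_trans _ _ (Num.min e 1)); first by rewrite lt_min e0 ltr01.
apply: le_inradius; first by rewrite le_min ltW//= ler01 ge_min lexx orbT.
by move=> w; rewrite lt_min => /andP[/eU].
Qed.

Lemma inradius_continuous : continuous inradius.
Proof.
move=> u; apply: cvg_rnormR => e e0; exists e => // v h.
exact: le_lt_trans (inradius_lip _ _) h.
Qed.

End Inradius.

(** * The max norm on C^n: coordinates and compactness of balls *)

Section RowNorm.
Variables (R : realType) (n : nat).
Implicit Types v : Cn R n.

(** The conjunct [0 <= e] covers n = 0, where there is no coordinate to bound [e] from below. *)
Lemma rnorm_rV_le v (e : R) :
  (rnorm v <= e) <-> (0 <= e /\ forall k, rnorm (v 0 k) <= e).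
Proof.
split=> [ve|[e0 ve]].
  split; first exact: le_trans (rnorm_ge0 _) ve.
  move=> k; rewrite leNgt; apply/negP => h.
  have : ball (0 : Cn R n) (rnorm (v 0 k))%:C v.
    by rewrite mx_norm_ball /ball_ /= sub0r normrN ltc_rnorm (le_lt_trans ve).
  by case=> _ /(_ 0 k); rewrite /ball /= mxE sub0r normrN ltc_rnorm ltxx.
have [v0|vn0] := eqVneq (mx_norm v) 0.
  by rewrite -lecR rnormE {1}/Num.Def.normr /= v0 lecR.
have [[i k] /= E] := mx_norm_neq0 vn0.
rewrite -lecR rnormE {1}/Num.Def.normr /= E -rnormE lecR (ord1 i); exact: ve.
Qed.

Lemma compact_rV_rnorm_le (r : R) : compact [set v : Cn R n | rnorm v <= r].
Proof.
have [r0|r0] := leP 0 r; last first.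
  rewrite (_ : mkset _ = set0); first exact: compact0.
  by apply/seteqP; split => // v /=; rewrite leNgt (lt_le_trans r0)// rnorm_ge0.
have -> : [set v : Cn R n | rnorm v <= r] =
    [set v | forall k, [set z : Cplx R | rnorm z <= r] (v 0 k)].
  by apply/seteqP; split => v /= h; [case/rnorm_rV_le : h|apply/rnorm_rV_le].
by apply: (@rV_compact _ n (fun=> [set z : Cplx R | rnorm z <= r])) => _; exact: compact_rnorm_le.
Qed.

End RowNorm.

(** * The continuity method for a family of analytic discs *)

Section AnalyticDiscs.
Variables (R : realType) (n : nat) (U : set (Cn R n)).
Hypotheses (oU : open U) (cpU : continuity_principle U).
Local Notation C := (Cplx R).

Section Family.
Variables (q : {poly C}) (b d w : Cn R n).
Hypotheses (w1 : rnorm w < 1)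
  (dU : forall z : C, closed_disc 0 1 z -> U (b + z *: d))
  (q1 : forall z : C, closed_disc 0 1 z -> 1 <= complex.Re q.[z])
  (qU : forall z : C, disc_boundary 0 1 z -> (rnorm q.[z])^-1 <= inradius U (b + z *: d)).

(** [l = 0] is the given affine disc, [l = 1] the translated disc to be reached. *)
Let G (l : R) (z : C) : Cn R n := b + z *: d + (l%:C / q.[z]) *: w.

Let rnorm_q z : closed_disc 0 1 z -> 1 <= rnorm q.[z].
Proof. by move=> /q1 h; exact: le_trans h (Re_le_rnorm _). Qed.

Let q_neq0 z : closed_disc 0 1 z -> q.[z] != 0.
Proof. by move=> /rnorm_q h; rewrite -rnorm_eq0 gt_eqF// (lt_le_trans ltr01). Qed.

Let open_closed z : open_disc 0 1 z -> closed_disc (0 : C) (1 : R) z.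
Proof. by rewrite in_open_disc in_closed_disc => /ltW. Qed.

Let boundary_closed z : disc_boundary 0 1 z -> closed_disc (0 : C) (1 : R) z.
Proof. by rewrite in_closed_disc => /in_disc_boundary ->. Qed.

(** As |w| < 1 <= |q|, the family is 1-Lipschitz in the parameter, uniformly on the disc. *)
Let G_dist l m z : closed_disc 0 1 z -> rnorm (G l z - G m z) <= `|l - m|.
Proof.
move=> z1; rewrite /G opprD addrACA subrr add0r -scalerBl -mulrBl -rmorphB /=.
rewrite rnormZ rnormM rnorm_real rnormV -mulrA ler_piMr//.
apply: mulr_ile1; rewrite ?invr_ge0 ?rnorm_ge0 ?(ltW w1)//.
by rewrite invf_le1 ?(lt_le_trans ltr01)// rnorm_q.
Qed.

Let G_derivable l z : closed_disc 0 1 z -> derivable (G l) z 1.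
Proof.
move=> z1.
have dZ (f : C -> C) (v : Cn R n) : derivable f z 1 -> derivable (fun x => f x *: v) z 1.
  rewrite /derivable => df.
  rewrite (_ : (fun h => _) = (fun h => (h^-1 *: (f (h *: 1 + z) - f z)) *: v)).
    exact: is_cvgZr_tmp.
  by apply/funext => h; rewrite -scalerBl scalerA.
apply: derivableD.
  by apply: derivableD; [exact: derivable_cst|apply: dZ; exact: derivable_id].
apply: dZ; apply: derivableZ; apply: derivableV; first exact: q_neq0.
exact: polyC_derivable.
Qed.

Let G_continuous l z : closed_disc 0 1 z -> {for z, continuous (G l)}.
Proof.
by move=> z1; apply: differentiable_continuous; apply/derivable1_diffP; exact: G_derivable.
Qed.

Let good l := forall z, closed_disc 0 1 z -> U (G l z).

Let good0 : good 0.
Proof. by move=> z z1; rewrite /G rmorph0 mul0r scale0r addr0; exact: dU. Qed.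

(** On the circle the displacement l|w|/|q| is less than 1/|q|, hence less than the inradius at the
    undisplaced point. *)
Let G_boundary l z : 0 <= l <= 1 -> disc_boundary 0 1 z -> U (G l z).
Proof.
move=> /andP[l0 l1] z1; apply: (@inradius_sub _ _ _ (b + z *: d)).
apply: lt_le_trans (qU z1).
rewrite /G addrAC subrr add0r rnormZ rnormM rnorm_real ger0_norm// rnormV.
have z1' := boundary_closed z1.
have q0 : 0 < (rnorm q.[z])^-1 by rewrite invr_gt0 (lt_le_trans ltr01)// rnorm_q.
rewrite mulrAC gtr_pMl//.
by rewrite (le_lt_trans _ w1)// ler_piMl// rnorm_ge0.
Qed.

(** The inradius has a positive minimum over the compact disc [G l], and a parameter change smaller
    than it cannot leave [U]. *)
Let good_open l : good l -> exists2 m : R, 0 < m & forall l', `|l' - l| < m -> good l'.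
Proof.
move=> gl.
have cI : {within closed_disc 0 1, continuous (fun z => inradius U (G l z))}.
  apply: within_continuousT => z z1; apply: continuous_comp; first exact: G_continuous.
  exact: inradius_continuous.
have D0 : closed_disc (0 : C) (1 : R) !=set0.
  by exists 0; rewrite in_closed_disc subrr rnorm0.
have [z0 /set_mem z01 h] := compact_EVT_min D0 (@closed_disc_compact _ 0 1) cI.
exists (inradius U (G l z0)); first exact/(inradius_gt0 _ oU)/gl.
move=> l' ll z z1; apply: (@inradius_sub _ _ _ (G l z)).
by apply: le_lt_trans (G_dist _ _ z1) _; apply: (lt_le_trans ll); apply: h; rewrite inE.
Qed.

(** The continuity principle is applied to discs with good parameters tending to [l]; the limit sets
    are the images under [G l] of the circle and of the closed disc. *)
Let good_closed l : 0 <= l <= 1 ->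
  (forall e : R, 0 < e -> exists2 l', good l' & `|l' - l| < e) -> good l.
Proof.
move=> l01 gl.
have /choice[L LP] : forall j : nat, exists l', good l' /\ `|l' - l| < j.+1%:R^-1.
  by move=> j; have [|l' ? ?] := gl j.+1%:R^-1; [rewrite invr_gt0 ltr0n|exists l'].
have L_lt (e : R) : 0 < e -> exists J, forall j, (J <= j)%N -> `|L j - l| < e.
  move=> e0; exists (Num.bound e^-1) => j Jj; apply: lt_le_trans (LP j).2 _.
  rewrite invf_ple ?posrE ?ltr0n//; apply: ltW.
  apply: (lt_trans (archi_boundP _)); first by rewrite invr_ge0 ltW.
  by rewrite ltr_nat ltnS.
have cG m : {within closed_disc 0 1, continuous (G m)}.
  by apply: within_continuousT => z; exact: G_continuous.
have bdry_closed : closed (disc_boundary (0 : C) (1 : R)).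
  rewrite (_ : disc_boundary _ _ = (@rnorm R C) @^-1` [set x | x = 1]).
    by apply: closed_comp; [move=> ? _; exact: rnorm_continuous|exact: closed_eq].
  apply/seteqP; split => z; first by move=> /in_disc_boundary; rewrite subr0.
  by move=> zE; apply/in_disc_boundary; rewrite subr0.
have main : G l @` closed_disc 0 1 `<=` U.
  apply: (cpU (S := fun j => G (L j)) (B := G l @` disc_boundary 0 1)).
  - move=> j; split; first exact: cG.
    by move=> z /open_closed; exact: G_derivable.
  - move=> j _ [[z /open_closed z1 <-]|[z /boundary_closed z1 <-]]; exact: (LP j).1.
  - apply: continuous_compact.
      by apply: continuous_subspaceW (cG l) => z; exact: boundary_closed.
    apply: subclosed_compact bdry_closed (@closed_disc_compact _ 0 1) _ => z.
    exact: boundary_closed.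
  - by move=> _ [z z1 <-]; exact: G_boundary.
  - exact: continuous_compact (@closed_disc_compact _ 0 1).
  - move=> e /L_lt[J JP]; exists J => j /JP jl.
    by split => _ [z z1 <-]; [exists (G l z)|exists (G (L j) z)] => //;
      try (by exists z); rewrite ltc_rnorm ?(rnormBC (G l z));
      apply: le_lt_trans (G_dist _ _ (boundary_closed z1)) jl.
  - move=> e e0; have e20 : 0 < e / 2 by rewrite divr_gt0.
    have [J JP] := L_lt _ e20; exists J => j /JP jl; split => _ [z z1 <-].
      have z1' := open_closed z1; exists (G l z); first by exists z.
      rewrite ltc_rnorm; apply: le_lt_trans (G_dist _ _ z1') _; lra.
    have [t t0 tP] := continuity_for_rnorm (@G_continuous l z z1) e20.
    (* A point of the closed disc may lie on the circle, whereas the approximating sets are images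
       of the open disc; so [z] is replaced by [(1 - s) z], at distance less than [t]. *)
    pose s : R := Num.min (t / 2) (1 / 2).
    have s0 : 0 < s by rewrite lt_min !divr_gt0.
    have s1 : s < 1 by rewrite gt_min [1 / 2 < 1]ltr_pdivrMr// mul1r ltr1n orbT.
    have st : s < t by rewrite gt_min ltr_pdivrMr// ltr_pMr// ltr1n.
    move: (z1); rewrite in_closed_disc subr0 => zn.
    pose v : C := (1 - s)%:C * z.
    have vo : open_disc 0 1 v.
      rewrite in_open_disc subr0 rnormM rnorm_real ger0_norm ?subr_ge0 ?(ltW s1)//.
      apply: (@le_lt_trans _ _ (1 - s)); last by lra.
      by rewrite ler_piMr// subr_ge0 ltW.
    exists (G (L j) v); first by exists v.
    rewrite ltc_rnorm; apply: le_lt_trans (rnorm_dist _ (G l v) _) _.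
    rewrite [e]splitr (rnormBC (G l v)) ltrD//.
      rewrite rnormBC; apply: tP; rewrite /v rmorphB mulrBl rmorph1 mul1r addrAC subrr add0r.
      rewrite rnormN rnormM rnorm_real gtr0_norm//.
      by apply: le_lt_trans st; rewrite ler_piMr// ltW.
    by apply: le_lt_trans (G_dist _ _ (open_closed vo)) jl.
by move=> z z1; apply: main; exists z.
Qed.

(* The set of admissible parameters in [0, 1] is closed by the continuity
   principle and open by compactness, so its supremum is 1. *)
Lemma unit_disc_translate z : closed_disc 0 1 z -> U (b + z *: d + q.[z]^-1 *: w).
Proof.
pose A := [set l : R | 0 <= l <= 1 /\ good l].
have A0 : A 0 by split; [rewrite lexx ler01|exact: good0].
have supA : has_sup A by split; [exists 0|exists 1 => l [/andP[]]].
pose c := sup A.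
have c01 : 0 <= c <= 1.
  rewrite sup_upper_bound//= ge_sup//; first by exists 0.
  by move=> l [/andP[]].
have gc : good c.
  apply: good_closed => // e e0; have [l Al lc] := sup_adherent e0 supA.
  exists l; first by case: Al.
  have := sup_upper_bound supA Al; rewrite -/c in lc * => h.
  by rewrite distrC ger0_norm ?subr_ge0//; lra.
have c1 : c = 1.
  apply/eqP; rewrite eq_le (andP c01).2 leNgt; apply/negP => c1.
  have [m m0 mP] := good_open gc.
  pose l := Num.min 1 (c + m / 2).
  have cl : c < l by rewrite lt_min c1 ltrDl divr_gt0.
  have lm : l <= c + m / 2 by rewrite ge_min lexx orbT.
  have Al : A l.
    split; last by apply: mP; rewrite gtr0_norm ?subr_gt0//; lra.
    by rewrite ge_min lexx andbT (le_trans (andP c01).1)// ltW.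
  by have := sup_upper_bound supA Al; rewrite leNgt cl.
by move=> z1; have := gc z z1; rewrite /G c1 div1r.
Qed.

End Family.

(** Reduction to the unit disc by the substitution z = a + r s. *)
Lemma disc_translate (q : {poly C}) (a : C) (r : R) (b d w : Cn R n) :
  0 < r -> rnorm w < 1 ->
  (forall z : C, closed_disc a r z -> U (b + z *: d)) ->
  (forall z : C, closed_disc a r z -> 1 <= complex.Re q.[z]) ->
  (forall z : C, disc_boundary a r z -> (rnorm q.[z])^-1 <= inradius U (b + z *: d)) ->
  forall z : C, closed_disc a r z -> U (b + z *: d + q.[z]^-1 *: w).
Proof.
move=> r0 w1 dU q1 qU z zr.
pose b' := b + a *: d; pose d' := r%:C *: d.
pose q' := q \Po (a%:P + r%:C *: 'X).
have bE s : b' + s *: d' = b + (a + r%:C * s) *: d.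
  by rewrite /b' /d' scalerA mulrC scalerDl addrA.
have qE s : q'.[s] = q.[a + r%:C * s].
  by rewrite horner_comp hornerD hornerC hornerZ hornerX.
have discE s : closed_disc 0 1 s -> closed_disc a r (a + r%:C * s).
  rewrite !in_closed_disc subr0 addrAC subrr add0r rnormM rnorm_real gtr0_norm// => s1.
  by rewrite ger_pMr.
have rC0 : r%:C != 0 :> C by rewrite -rnorm_eq0 rnorm_real gtr0_norm// gt_eqF.
have := @unit_disc_translate q' b' d' w w1 _ _ _ ((z - a) / r%:C).
have zE : a + r%:C * ((z - a) / r%:C) = z by rewrite mulrCA mulfV// mulr1 addrC subrK.
rewrite bE qE zE; apply.
- by move=> s /discE; rewrite bE; exact: dU.
- by move=> s /discE; rewrite qE; exact: q1.
- move=> s /in_disc_boundary; rewrite subr0 => s1; rewrite bE qE; apply: qU.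
  apply/in_disc_boundary; rewrite addrAC subrr add0r rnormM rnorm_real gtr0_norm//.
  by rewrite s1 mulr1.
- move: zr; rewrite !in_closed_disc subr0 rnormM rnormV rnorm_real gtr0_norm// => zr.
  by rewrite ler_pdivrMr// mul1r.
Qed.

End AnalyticDiscs.

(** * The plurisubharmonic exhaustion function *)

Section PlurisubharmonicExhaustion.
Variable R : realType.
Local Notation C := (Cplx R).

Lemma open_disc_open (a : C) (r : R) : open (open_disc a r).
Proof.
rewrite openE => z; rewrite in_open_disc => zr; apply/nbhs_rnorm.
exists (r - rnorm (z - a)); first by rewrite subr_gt0.
move=> w wz; rewrite in_open_disc; apply: le_lt_trans (rnorm_dist _ z _) _; lra.
Qed.

Lemma Re_poly_le_harmonic (p : {poly C}) (phi : C -> R) (a : C) (r : R) :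
  {within closed_disc a r, continuous phi} -> harmonic_on (open_disc a r) phi ->
  (forall z, disc_boundary a r z -> complex.Re p.[z] <= phi z) ->
  forall z, open_disc a r z -> complex.Re p.[z] <= phi z.
Proof.
move=> cphi hphi bd z zr; rewrite -subr_ge0.
apply: (@minimum_principle _ (fun z => phi z - complex.Re p.[z]) a r) => //.
- apply: within_continuousB => //; apply: continuous_subspaceT => w.
  by apply: continuous_comp; [exact: polyC_continuous|exact: Re_continuous].
- move=> w wr; apply: flatB; last exact: flat_Re_poly.
  exact: flat_harmonic (@open_disc_open a r) wr hphi.
- by move=> w /bd; rewrite subr_ge0.
Qed.

(** This keeps the polynomial away from 0 on the whole disc, so that its inverse is holomorphic
    there. *)
Lemma Re_poly_ge1 (p : {poly C}) (a : C) (r : R) :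
  (forall z, disc_boundary a r z -> 1 <= complex.Re p.[z]) ->
  forall z, closed_disc a r z -> 1 <= complex.Re p.[z].
Proof.
move=> bd z; rewrite in_closed_disc le_eqVlt => /orP[/eqP/in_disc_boundary/bd //|].
rewrite -in_open_disc; move: z.
have E (z : C) : complex.Re (p - 1).[z] = complex.Re p.[z] - 1.
  by rewrite hornerD hornerN -[1]/(1%:P) hornerC raddfB.
move=> z zr; rewrite -subr_ge0 -E.
apply: (@minimum_principle _ (fun z => complex.Re (p - 1).[z]) a r) => //.
- apply: continuous_subspaceT => w.
  by apply: continuous_comp; [exact: polyC_continuous|exact: Re_continuous].
- by move=> w _; exact: flat_Re_poly.
- by move=> w /bd; rewrite E subr_ge0.
Qed.

Lemma unimodular_factor (c : C) : exists2 u : C, rnorm u = 1 & complex.Re (u * c) = rnorm c.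
Proof.
have [->|c0] := eqVneq c 0; first by exists 1; rewrite ?rnorm1 ?mulr0 ?rnorm0.
have n0 : rnorm c != 0 by rewrite rnorm_eq0.
exists (`|c| / c); first by rewrite rnormM rnormV -rnormE rnorm_real ger0_norm ?rnorm_ge0 ?mulfV.
by rewrite mulfVK// -rnormE.
Qed.

Variables (n : nat) (U : set (Cn R n)).
Implicit Types (b d v : Cn R n) (a z : C) (phi : C -> R) (r : R).

(** At the given point, the modulus of each coordinate is the real part of a rotated affine
    polynomial. On the circle that real part is at most the norm, hence at most [phi], and the
    maximum principle carries the bound inside. *)
Lemma rnorm_line_subharmonic b d phi a r :
  {within closed_disc a r, continuous phi} -> harmonic_on (open_disc a r) phi ->
  (forall z, disc_boundary a r z -> rnorm (b + z *: d) <= phi z) ->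
  forall z, open_disc a r z -> rnorm (b + z *: d) <= phi z.
Proof.
move=> cphi hphi bd z zr; apply/rnorm_rV_le; split.
  have := @Re_poly_le_harmonic 0 phi a r cphi hphi _ z zr; rewrite horner0; apply => w wr.
  by rewrite horner0 (le_trans _ (bd w wr))// rnorm_ge0.
move=> k; have [u u1 uE] := unimodular_factor ((b + z *: d) 0 k).
pose p : {poly C} := u *: ((b 0 k)%:P + d 0 k *: 'X).
have pE w : p.[w] = u * (b + w *: d) 0 k.
  by rewrite hornerZ hornerD hornerC hornerZ hornerX !mxE (mulrC w).
rewrite -uE -pE; apply: (Re_poly_le_harmonic cphi hphi) zr => w wr.
rewrite pE; apply: le_trans (Re_le_rnorm _) _; rewrite rnormM u1 mul1r.
by apply: le_trans (bd w wr); case/rnorm_rV_le : (lexx (rnorm (b + w *: d))).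
Qed.

Hypotheses (oU : open U) (cpU : continuity_principle U).

(* On the circle [phi] is approximated from above by [Re p]. Subtracting the
   constant [i Im p(z0)] from [p] leaves [Re p] unchanged and makes [p z0]
   real, so discs translated by multiples of [1 / p] sweep out a ball of
   radius [1 / Re p(z0)]. *)
Lemma inv_inradius_line_subharmonic b d phi a r :
  0 < r -> (forall z, closed_disc a r z -> U (b + z *: d)) ->
  {within closed_disc a r, continuous phi} -> harmonic_on (open_disc a r) phi ->
  (forall z, disc_boundary a r z -> (inradius U (b + z *: d))^-1 <= phi z) ->
  forall z, open_disc a r z -> (inradius U (b + z *: d))^-1 <= phi z.
Proof.
move=> r0 dU cphi hphi bd z zr; apply/ler_addgt0Pr => e e0.
have [p pP] := circle_approx r0 cphi e0.
pose q := p - (('i%C : C) * (complex.Im p.[z])%:C)%:P.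
have ReE w : complex.Re q.[w] = complex.Re p.[w].
  rewrite hornerD hornerN hornerC raddfB /=; simpc; rewrite /=; ring.
have qz : q.[z] = (complex.Re p.[z])%:C.
  by rewrite hornerD hornerN hornerC {1}(complexE p.[z]) addrK.
have I0 w : closed_disc a r w -> 0 < inradius U (b + w *: d).
  by move=> /dU; exact: (inradius_gt0 _ oU).2.
have bcl w : disc_boundary a r w -> closed_disc a r w.
  by rewrite in_closed_disc => /in_disc_boundary ->.
have bdq w : disc_boundary a r w -> (inradius U (b + w *: d))^-1 <= complex.Re q.[w].
  by move=> wr; rewrite ReE; apply: le_trans (bd w wr) _; case/andP: (pP w wr).
(* The truncation of the inradius at 1 makes its inverse at least 1 on the circle. *)
have q1 : forall w, closed_disc a r w -> 1 <= complex.Re q.[w].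
  apply: Re_poly_ge1 => w wr; apply: le_trans (bdq w wr).
  by rewrite invf_ge1 ?inradius_le1 ?I0//; exact: bcl.
have qU w : disc_boundary a r w -> (rnorm q.[w])^-1 <= inradius U (b + w *: d).
  move=> wr; have Iw := I0 w (bcl w wr).
  rewrite invf_ple ?posrE//; first exact: le_trans (bdq w wr) (Re_le_rnorm _).
  exact: lt_le_trans ltr01 (le_trans (q1 w (bcl w wr)) (Re_le_rnorm _)).
have zr' : closed_disc a r z by move: zr; rewrite in_open_disc in_closed_disc => /ltW.
have P1 := q1 z zr'; rewrite ReE in P1.
have P0 := lt_le_trans ltr01 P1.
have Pn : (complex.Re p.[z])%:C != 0 :> C by rewrite -rnorm_eq0 rnorm_real gtr0_norm ?gt_eqF.
have sweep : (complex.Re p.[z])^-1 <= inradius U (b + z *: d).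
  apply: le_inradius; first by rewrite invr_ge0 (ltW P0) invf_le1.
  (* This [w] is chosen so that the translate by [q.[z]^-1 *: w] takes the centre to [v]. *)
  move=> v vz; have w1 : rnorm ((complex.Re p.[z])%:C *: (v - (b + z *: d))) < 1.
    by rewrite rnormZ rnorm_real gtr0_norm// mulrC -ltr_pdivlMr// div1r.
  have := disc_translate oU cpU r0 w1 dU q1 qU zr'.
  by rewrite qz scalerA mulVf// scale1r addrC subrK.
apply: (@le_trans _ _ (complex.Re p.[z])); first by rewrite invf_ple ?posrE// I0.
(* Lowering [p] by [e] puts its real part below [phi] on the circle, hence inside. *)
have := @Re_poly_le_harmonic (p - (e%:C : C)%:P) phi a r cphi hphi _ z zr.
have E w : complex.Re (p - (e%:C : C)%:P).[w] = complex.Re p.[w] - e.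
  by rewrite hornerD hornerN hornerC raddfB.
rewrite E lerBlDr; apply => w wr; rewrite E lerBlDr.
by case/andP: (pP w wr).
Qed.

(** The norm keeps sublevel sets bounded, the inverse inradius keeps them away from the complement
    of [U]. Outside [U] the inradius is 0 and its inverse takes the default value 0. *)
Definition psh_exhaustion v : R := Num.max (rnorm v) (inradius U v)^-1.

Lemma psh_exhaustion_continuous v : U v -> {for v, continuous psh_exhaustion}.
Proof.
move=> Uv; apply: (@continuous_max R _ (@rnorm R _) (fun u => (inradius U u)^-1)).
  exact: rnorm_continuous.
apply: continuousV; last exact: inradius_continuous.
by rewrite gt_eqF//; apply/inradius_gt0.
Qed.

Lemma psh_exhaustion_exhaustion : exhaustion U psh_exhaustion.
Proof.
move=> r; have [r0|r0] := leP r 0.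
  rewrite (_ : mkset _ = set0); first exact: compact0.
  apply/seteqP; split => // v [/(inradius_gt0 _ oU) Uv].
  by rewrite /psh_exhaustion ge_max => /andP[_ /le_trans /(_ r0)]; rewrite invr_le0 leNgt Uv.
(* For r > 0 the condition on the inradius already forces membership in [U], so the sublevel set is
   closed in all of C^n. *)
rewrite (_ : mkset _ = [set v : Cn R n | rnorm v <= r] `&` (inradius U) @^-1` [set t | r^-1 <= t]).
  apply: compact_closedI; first exact: compact_rV_rnorm_le.
  by apply: closed_comp; [move=> ? _; exact: inradius_continuous|exact: closed_ge].
apply/seteqP; split => v /=; rewrite /psh_exhaustion.
  move=> [/(inradius_gt0 _ oU) Uv]; rewrite ge_max => /andP[-> h]; split=> //.
  by rewrite invf_ple ?posrE.
move=> [vr rv]; have I0 : 0 < inradius U v by apply: lt_le_trans rv; rewrite invr_gt0.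
split; first exact/(inradius_gt0 _ oU).
by rewrite ge_max vr /= invf_ple ?posrE.
Qed.

Lemma psh_exhaustion_usc (A : set C) (l : C -> Cn R n) :
  continuous l -> (forall z, A z -> U (l z)) ->
  upper_semicontinuous_on A (fun z => (psh_exhaustion (l z))%:E).
Proof.
move=> cl AU z /AU Uz c; rewrite lte_fin => fc.
have : {for z, continuous (psh_exhaustion \o l)}.
  by apply: continuous_comp; [exact: cl|exact: psh_exhaustion_continuous].
by move=> /cvgr_lt /(_ _ fc); apply: filterS => w wc _; rewrite lte_fin.
Qed.

Lemma psh_exhaustion_plurisubharmonic :
  plurisubharmonic U (fun v => (psh_exhaustion v)%:E).
Proof.
split.
- by move=> v _; exact: ltry.
- move=> v Uv c; rewrite lte_fin => fc.
  have /cvgr_lt /(_ _ fc) := psh_exhaustion_continuous Uv.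
  by apply: filterS => w wc _; rewrite lte_fin.
move=> b d Ub _; split.
- by move=> z _; exact: ltry.
- apply: psh_exhaustion_usc => // z; apply: cvg_rnorm => e e0.
  exists (e / (rnorm d + 1)); first by rewrite divr_gt0// ltr_wpDl ?rnorm_ge0.
  move=> w wz; rewrite opprD addrACA subrr add0r -scalerBl rnormZ.
  have d1 : 0 < rnorm d + 1 by rewrite ltr_wpDl ?rnorm_ge0.
  rewrite ltr_pdivlMr// in wz; apply: le_lt_trans wz.
  by rewrite ler_wpM2l ?rnorm_ge0// lerDl.
(* A maximum lies below [phi] exactly when both functions do, so each is treated separately. *)
move=> a r phi r0 DU cphi hphi bd z zr; rewrite lee_fin ge_max; apply/andP; split.
  apply: (rnorm_line_subharmonic cphi hphi) zr => w /bd.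
  by rewrite lee_fin ge_max => /andP[].
apply: (inv_inradius_line_subharmonic r0 DU cphi hphi) zr => w /bd.
by rewrite lee_fin ge_max => /andP[].
Qed.

End PlurisubharmonicExhaustion.

Theorem theorem4p18 (R : realType) (n : nat) (U : set (Cn R n)) :
  domain U -> continuity_principle U -> pseudoconvex U.
Proof.
move=> domU cpU; have oU := domU.1; split=> //; exists (psh_exhaustion U); split.
- by apply: within_continuousT => v; exact: psh_exhaustion_continuous.
- exact: psh_exhaustion_plurisubharmonic.
- exact: psh_exhaustion_exhaustion.
Qed.
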